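(* Let $\Omega_1$ and $\Omega_2$ be convex subsets of a real locally convex topological vector space $X$ such that $\Omega_1\cap\Omega_2\ne\emptyset$. Assume that $\operatorname{iri}(\Omega_1)\ne\emptyset$, $\operatorname{iri}(\Omega_2)\ne\emptyset$, and $\Omega_1-\Omega_2$ is quasi-regular. Then $\Omega_1$ and $\Omega_2$ are properly separated if and only if $$\operatorname{qri}(\Omega_1)\cap\operatorname{qri}(\Omega_2)=\emptyset.$$
   Context: Two convex sets $\Omega_1,\Omega_2\subset X$ are properly separated if there exists $x^*\in X^*$ (the topological dual of $X$) such that $\sup\{\langle x^*,w_1\rangle\mid w_1\in\Omega_1\}\le\inf\{\langle x^*,w_2\rangle\mid w_2\in\Omega_2\}$ and $\inf\{\langle x^*,w_1\rangle\mid w_1\in\Omega_1\}<\sup\{\langle x^*,w_2\rangle\mid w_2\in\Omega_2\}$. For subsets $A,B$ of $X$, $A-B:=\{a-b\mid a\in A,\ b\in B\}$. For a nonempty subset $A$ of $X$, $\operatorname{cone}(A):=\{ta\mid t\ge 0,\ a\in A\}$ and $\overline{\operatorname{cone}}(A)$ is its closure. For a nonempty convex set $\Omega\subset X$, the intrinsic relative interior is $\operatorname{iri}(\Omega):=\{x\in\Omega\mid \operatorname{cone}(\Omega-x)\text{ is a linear subspace of }X\}$ and the quasi-relative interior is $\operatorname{qri}(\Omega):=\{x\in\Omega\mid \overline{\operatorname{cone}}(\Omega-x)\text{ is a linear subspace of }X\}$; by convention $\operatorname{iri}(\emptyset)=\operatorname{qri}(\emptyset)=\emptyset$. A convex set $\Omega$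 is called quasi-regular if $\operatorname{qri}(\Omega)=\operatorname{iri}(\Omega)$. *)

(* Defs.v *)
From HB Require Import structures.
From mathcomp Require Import all_boot all_order all_algebra.
From mathcomp Require Import all_classical all_reals all_analysis.

Set Implicit Arguments.
Unset Strict Implicit.
Unset Printing Implicit Defensive.

Import Order.TTheory GRing.Theory Num.Theory.
Import numFieldNormedType.Exports.

Local Open Scope classical_set_scope.
Local Open Scope ring_scope.

Definition setB (X : zmodType) (A B : set X) : set X :=
  [set a - b | a in A & b in B].

Definition cone (R : realType) (X : lmodType R) (A : set X) : set X :=
  [set t *: a | t in [set t : R | 0 <= t] & a in A].

Definition linear_subspace (R : realType) (X : lmodType R) (L : set X) : Prop :=
  submod_closed (mem L).

Definition iri (R : realType) (X : lmodType R) (Omega : set X) : set X :=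
  [set x | Omega x /\ linear_subspace (cone (setB Omega [set x]))].

Definition qri (R : realType) (X : tvsType R) (Omega : set X) : set X :=
  [set x | Omega x /\ linear_subspace (closure (cone (setB Omega [set x])))].

(* The convexity of [Omega] is not part of the definition: it is meant to be
   applied to convex sets only. *)
Definition quasi_regular (R : realType) (X : tvsType R) (Omega : set X) : Prop :=
  qri Omega = iri Omega.

(* Suprema and infima are taken in [\bar R], since a functional may be
   unbounded on either set. *)
Definition properly_separated (R : realType) (X : tvsType R)
    (Omega1 Omega2 : set X) : Prop :=
  exists f : {linear X -> R^o},
    [/\ continuous f,
        (ereal_sup [set (f w)%:E | w in Omega1]
           <= ereal_inf [set (f w)%:E | w in Omega2])%E
      & (ereal_inf [set (f w)%:E | w in Omega1]
           < ereal_sup [set (f w)%:E | w in Omega2])%E].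

(* Main.v *)
Require Import Defs.
From HB Require Import structures.
From mathcomp Require Import all_boot all_order all_algebra.
From mathcomp Require Import all_classical all_reals all_analysis.
From mathcomp Require Import lra.

Set Implicit Arguments.
Unset Strict Implicit.
Unset Printing Implicit Defensive.

Import Order.TTheory GRing.Theory Num.Theory.
Import numFieldNormedType.Exports.

Local Open Scope classical_set_scope.
Local Open Scope ring_scope.

(* A functional separating [Omega1] and [Omega2] is constant on each of them as
   soon as their quasi-relative interiors meet, since a functional that is
   nonpositive on a linear subspace vanishes there.  Conversely, if no
   functional separates them properly, then every continuous functional
   nonpositive on [D = Omega1 - Omega2] vanishes on [D], so by Hahn-Banach the
   closed cone of [D] is a subspace, i.e. [0] is in [qri D = iri D].  If
   [a], [b] are in [iri Omega1], [iri Omega2], then [b - a = t (c - d)] for some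
   [c], [d] in [Omega1], [Omega2] and [t >= 0]; dividing [a + t c = b + t d] by
   [1 + t] gives a common point of the two intrinsic relative interiors.

   Hahn-Banach is obtained without extending functionals: a convex cone maximal
   among those avoiding [e] contains [x] or [- x] for every [x], and it is the
   half-space [f <= 0] of [f x = inf {t | x - t e in the cone}]. *)

(** * Convex sets, convex cones and intrinsic relative interiors *)

Section ConvexCones.
Context (R : realType) (X : lmodType R).
Implicit Types (A B C : set X) (x y : X) (s t : R).

Definition convex_cone C : Prop :=
  [/\ C 0, forall x y, C x -> C y -> C (x + y)
    & forall t x, 0 <= t -> C x -> C (t *: x)].

Lemma convex_set_comb A x y s t : convex_set A -> A x -> A y ->
  0 <= s -> 0 <= t -> s + t = 1 -> A (s *: x + t *: y).
Proof.
move=> cA Ax Ay s0 t0 st1.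
have s1 : s <= 1 by rewrite -st1 lerDl.
have := cA x y (Itv01 s0 s1) (mem_set Ax) (mem_set Ay).
by rewrite inE; have -> : t = 1 - s by lra.
Qed.

Lemma convex_set_scaleD A x y s t : convex_set A -> A x -> A y ->
  0 <= s -> 0 <= t -> exists2 z, A z & s *: x + t *: y = (s + t) *: z.
Proof.
move=> cA Ax Ay s0 t0; have [st0|st0] := eqVneq (s + t) 0.
  have [-> ->] : s = 0 /\ t = 0 by split; lra.
  by exists x => //; rewrite !scale0r !addr0 scale0r.
exists ((s / (s + t)) *: x + (t / (s + t)) *: y).
  apply: convex_set_comb => //; rewrite ?divr_ge0 ?addr_ge0//.
  by rewrite -mulrDl divff.
by rewrite scalerDr !scalerA ![(s + t) * _]mulrC !divfK.
Qed.

Lemma convex_setB A B : convex_set A -> convex_set B -> convex_set (setB A B).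
Proof.
move=> cA cB x y l; rewrite !inE => -[a Aa [b Bb <-]] [a' Aa' [b' Bb' <-]].
exists (conv l (a : convex_lmodType X) a').
  by apply/set_mem/cA; apply/mem_set.
exists (conv l (b : convex_lmodType X) b').
  by apply/set_mem/cB; apply/mem_set.
by rewrite /conv/= !scalerBr opprD addrACA.
Qed.

Lemma convex_set1 x : convex_set [set x].
Proof. by move=> a b l; rewrite !inE => -> ->; rewrite convmm. Qed.

Lemma cone_convex_cone A : convex_set A -> A !=set0 -> convex_cone (cone A).
Proof.
move=> cA [a Aa]; split.
- by exists 0 => //=; exists a => //; rewrite scale0r.
- move=> _ _ [s /= s0 [x Ax <-]] [t /= t0 [y Ay <-]].
  have [z Az ->] := convex_set_scaleD cA Ax Ay s0 t0.
  by exists (s + t); rewrite /= ?addr_ge0//; exists z.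
- move=> t _ t0 [s /= s0 [x Ax <-]].
  by exists (t * s); rewrite /= ?mulr_ge0//; exists x; rewrite ?scalerA.
Qed.

Lemma setB_convex_cone A B :
  convex_cone A -> convex_cone B -> convex_cone (setB A B).
Proof.
move=> [A0 AD AZ] [B0 BD BZ]; split.
- by exists 0 => //; exists 0 => //; rewrite subrr.
- move=> _ _ [a Aa [b Bb <-]] [a' Aa' [b' Bb' <-]].
  exists (a + a'); first exact: AD.
  by exists (b + b'); [exact: BD|rewrite opprD addrACA].
- move=> t _ t0 [a Aa [b Bb <-]].
  exists (t *: a); first exact: AZ.
  by exists (t *: b); [exact: BZ|rewrite scalerBr].
Qed.

Lemma cone_setB1 A x y : A y -> cone (setB A [set x]) (y - x).
Proof.
by move=> Ay; exists 1; rewrite /= ?ler01//; exists (y - x);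
  rewrite ?scale1r//; exists y => //; exists x.
Qed.

Lemma cone_setB1_convex A x : convex_set A -> A x ->
  convex_cone (cone (setB A [set x])).
Proof.
move=> cA Ax; apply: cone_convex_cone; last first.
  by exists (x - x); exists x => //; exists x.
by apply: convex_setB => //; exact: convex_set1.
Qed.

Lemma linear_subspaceP A : linear_subspace A <->
  A 0 /\ forall t x y, A x -> A y -> A (t *: x + y).
Proof.
split=> [[A0 AL]|[A0 AL]].
  split; first exact/set_mem.
  by move=> t x y Ax Ay; apply/set_mem; apply: AL; apply/mem_set.
split; first exact/mem_set.
by move=> t x y /set_mem Ax /set_mem Ay; apply/mem_set; exact: AL.
Qed.

Lemma linear_subspaceN A x : linear_subspace A -> A x -> A (- x).
Proof.
by move=> /linear_subspaceP[A0 AL] Ax; have := AL (-1) x 0 Ax A0;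
  rewrite addr0 scaleN1r.
Qed.

Lemma convex_cone_subspace C : convex_cone C ->
  (forall x, C x -> C (- x)) -> linear_subspace C.
Proof.
move=> [C0 CD CZ] CN; apply/linear_subspaceP; split=> // t x y Cx Cy.
apply: CD => //; have [t0|t0] := leP 0 t; first exact: CZ.
by rewrite -[t]opprK scaleNr; apply/CN/CZ => //; rewrite oppr_ge0 ltW.
Qed.

(** Let [z] be the combination. For [w] in [A], [z - w = t (y - x) - (w - x)] lies in the subspace
    spanned at [x], so it is [q (v - x)] with [v] in [A]. Since [s (v - x) = (s v + t y) - z], the
    vector [z - w] is also in the cone at [z], which is therefore closed under opposites. *)
Lemma iri_comb A x y s t : convex_set A -> iri A x -> A y ->
  0 < s -> 0 <= t -> s + t = 1 -> iri A (s *: x + t *: y).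
Proof.
move=> cA [Ax Lx] Ay s0 t0 st1.
have Az : A (s *: x + t *: y) by apply: convex_set_comb => //; exact: ltW.
split=> //; set z := s *: x + t *: y.
have cz := cone_setB1_convex cA Az.
apply: convex_cone_subspace => // _ [r /= r0 [_ [w Aw [_ -> <-]] <-]].
have [_ _ czZ] := cz; rewrite -scalerN; apply: czZ => //; rewrite opprB.
have /linear_subspaceP[_ LxL] := Lx.
have : cone (setB A [set x]) (z - w).
  have -> : z - w = t *: (y - x) + - (w - x).
    rewrite /z; have -> : s = 1 - t by lra.
    rewrite scalerBl scale1r scalerBr opprB addrA; congr (_ - w).
    by rewrite [RHS]addrC -addrA; congr (x + _); rewrite addrC.
  by apply: LxL; [|apply: linear_subspaceN => //]; exact: cone_setB1.
move=> [q /= q0 [_ [v Av [_ -> <-]] <-]].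
exists (q / s); first by rewrite /= divr_ge0 // ltW.
exists (s *: v + t *: y - z).
  exists (s *: v + t *: y); last by exists z.
  by apply: convex_set_comb => //; exact: ltW.
rewrite /z opprD addrACA subrr addr0 -scalerBr scalerA divfK ?gt_eqF//.
Qed.

Lemma iri_setB A B : convex_set A -> convex_set B ->
  iri A !=set0 -> iri B !=set0 -> iri (setB A B) 0 -> iri A `&` iri B !=set0.
Proof.
move=> cA cB [a ia] [b ib] [_ L0].
have /(linear_subspaceN L0) : cone (setB (setB A B) [set 0]) (a - b).
  rewrite -[a - b]subr0; apply: cone_setB1.
  by exists a; [case: ia|exists b => //; case: ib].
rewrite opprB => -[t /= t0 [_ [_ [c Ac [d Bd <-]] [_ -> <-]] tE]].
have t1 : 0 < 1 + t by rewrite ltr_wpDr.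
have st1 : (1 + t)^-1 + t / (1 + t) = 1.
  by rewrite -[X in X + _]mul1r -mulrDl divff ?gt_eqF.
exists ((1 + t)^-1 *: a + (t / (1 + t)) *: c); split.
  by apply: iri_comb => //; rewrite ?invr_gt0// divr_ge0// ltW.
suff -> : (1 + t)^-1 *: a + (t / (1 + t)) *: c =
          (1 + t)^-1 *: b + (t / (1 + t)) *: d.
  by apply: iri_comb => //; rewrite ?invr_gt0// divr_ge0// ltW.
rewrite ![t / _]mulrC -!scalerA -!scalerDr; congr (_ *: _).
move: tE; rewrite subr0 scalerBr => /eqP; rewrite subr_eq => /eqP ->.
by rewrite addrA [b - a]addrC addrA subrr add0r.
Qed.

(** * Maximal convex cones avoiding a point *)

Lemma convex_cone_bigcup C (F : set (set X)) : convex_cone C ->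
  (forall K, F K -> convex_cone (C `|` K)) -> total_on F subset ->
  convex_cone (C `|` \bigcup_(K in F) K).
Proof.
move=> [C0 CD CZ] FC Ftot.
have sub K : F K -> C `|` K `<=` C `|` \bigcup_(K in F) K.
  by move=> FK x [Cx|Kx]; [left|right; exists K].
split; first by left.
- move=> x y [Cx|[K FK Kx]] [Cy|[K' FK' K'y]].
  + by left; exact: CD.
  + by apply: (sub _ FK'); have [_ + _] := FC _ FK'; apply; [left|right].
  + by apply: (sub _ FK); have [_ + _] := FC _ FK; apply; [right|left].
  + have [KK'|K'K] := Ftot _ _ FK FK'.
      apply: (sub _ FK'); have [_ + _] := FC _ FK'.
      by apply; right => //; exact: KK'.
    apply: (sub _ FK); have [_ + _] := FC _ FK.
    by apply; right => //; exact: K'K.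
- move=> t x t0 [Cx|[K FK Kx]]; first by left; exact: CZ.
  by apply: (sub _ FK); have [_ _] := FC _ FK; apply=> //; right.
Qed.

(** If a maximal cone [M] contained neither [x] nor [- x], adjoining either one would capture [e]:
    [e = k + s x = k' - s' x] with [s], [s'] positive. Weighting these by [s'] and [s] eliminates
    [x] and puts [e] in [M]. *)
Lemma total_cone_avoiding C (e : X) : convex_cone C -> ~ C e ->
  exists K, [/\ convex_cone K, C `<=` K, ~ K e & forall x, K x \/ K (- x)].
Proof.
move=> cC Ce.
have [|K [[cK Ke] Kmax]] :=
  (* Joining [C] to each member keeps the empty chain admissible: its union is empty, and [C] itself
     is a cone avoiding [e]. *)
  @Zorn_bigcup X [set K | convex_cone (C `|` K) /\ ~ (C `|` K) e].
  move=> F FP Ftot; split.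
    by apply: convex_cone_bigcup => // K /FP[].
  by move=> [//|[K /FP[_ Ke] ?]]; apply: Ke; right.
exists (C `|` K); split=> //.
have [K0 KD KZ] := cK; set M := C `|` K in cK Ke K0 KD KZ *.
have extend x : ~ M x -> exists k s, [/\ M k, 0 < s & e = k + s *: x].
  (* [N] is the cone generated by [M] and [x]. It strictly extends [K], so maximality forces [e]
     into it; the coefficient of [x] is nonzero because [e] is not in [M]. *)
  move=> Mx; pose N := [set y | exists k s, [/\ M k, 0 <= s & y = k + s *: x]].
  have MN : M `<=` N.
    by move=> y My; exists y, 0; split=> //; rewrite scale0r addr0.
  have cN : convex_cone N.
    split; first exact: MN.
    - move=> _ _ [k [s [Mk s0 ->]]] [k' [s' [Mk' s'0 ->]]].
      exists (k + k'), (s + s'); split; [exact: KD|exact: addr_ge0|].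
      by rewrite scalerDl addrACA.
    - move=> t _ t0 [k [s [Mk s0 ->]]]; exists (t *: k), (t * s).
      by split; [exact: KZ|exact: mulr_ge0|rewrite scalerDr scalerA].
  have CN : C `|` N = N by rewrite setUidr// => y Cy; apply: MN; left.
  have Ne : N e.
    apply: contrapT => Ne; apply: (Kmax N); last by split; rewrite CN.
    split; first by move=> y Ky; apply: MN; right.
    move=> NK; apply: Mx; right; apply: NK.
    by exists 0, 1; split=> //; rewrite scale1r add0r.
  move: Ne => [k [s [Mk s0 eE]]]; exists k, s; split=> //.
  rewrite lt_neqAle s0 andbT; apply/eqP => s0'; apply: Ke.
  by rewrite eE -s0' scale0r addr0.
move=> x; apply: contrapT => /not_orP[Mx MNx]; apply: Ke.
have [k [s [Mk s0 eE]]] := extend _ Mx.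
have [k' [s' [Mk' s'0 eE']]] := extend _ MNx.
suff -> : e = (s + s')^-1 *: (s' *: k + s *: k').
  apply: (KZ); first by rewrite invr_ge0 addr_ge0 ?ltW.
  by apply: KD; apply: KZ => //; exact: ltW.
have ss : s + s' != 0 by rewrite gt_eqF ?addr_gt0.
apply: (scalerI ss); rewrite scalerA divff// scale1r scalerDl.
rewrite {1}eE' [in s' *: e]eE !scalerDr !scalerA scalerN [s' * s]mulrC.
by rewrite addrACA addNr addr0 addrC.
Qed.

End ConvexCones.

(** * The linear functional of a total cone *)

Section TotalConeFunctional.
Context (R : realType) (X : lmodType R) (K : set X) (e : X).
Context (cK : convex_cone K) (Ke : ~ K e).
Context (Ktotal : forall x, K x \/ K (- x)).
(** This makes [- e] an internal point of [K], so that the infimum defining the functional is finite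
    everywhere. *)
Context (Kunit : forall x, exists2 s, 0 < s & K (s *: x - e)).

Let K0 : K 0. Proof. by have [] := cK. Qed.
Let KD x y : K x -> K y -> K (x + y). Proof. by have [_ + _] := cK; apply. Qed.
Let KZ (t : R) x : 0 <= t -> K x -> K (t *: x).
Proof. by have [_ _] := cK; apply. Qed.

(** Since [- e] is in [K], the set of such [t] is an upward closed half-line, and the infimum is its
    endpoint. *)
Definition cone_functional (x : X) : R := inf [set t : R | K (x - t *: e)].

Local Notation f := cone_functional.

Let KN : K (- e).
Proof. by have [s _] := Kunit 0; rewrite scaler0 sub0r. Qed.

Let Ke_ge0 (t : R) : K (- (t *: e)) -> 0 <= t.
Proof.
move=> Kt; rewrite leNgt; apply/negP => t0; apply: Ke.
have -> : e = (- t)^-1 *: - (t *: e).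
  by rewrite -scaleNr scalerA mulVf ?scale1r// gt_eqF// oppr_gt0.
by apply: KZ => //; rewrite invr_ge0 oppr_ge0 ltW.
Qed.

Let has_inf_f x : has_inf [set t : R | K (x - t *: e)].
Proof.
split.
  have [s s0 Ks] := Kunit x; exists s^-1 => /=.
  have -> : x - s^-1 *: e = s^-1 *: (s *: x - e).
    by rewrite scalerBr scalerA mulVf ?gt_eqF// scale1r.
  by apply: KZ => //; rewrite invr_ge0 ltW.
(* Adding [s (x - t e)] to [s (- x) - e] gives [- (1 + s t) e] in [K], which forces
   [1 + s t >= 0]. *)
have [s s0 Ks] := Kunit (- x); exists (- s^-1) => t /= Kt.
rewrite -(ler_pM2l s0) mulrN divff ?gt_eqF// -subr_ge0 opprK.
apply: Ke_ge0; rewrite scalerDl scale1r opprD.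
have -> : - ((s * t) *: e) - e = s *: (x - t *: e) + (s *: (- x) - e).
  by rewrite scalerBr scalerN scalerA addrACA subrr add0r.
by apply: KD => //; apply: KZ => //; exact: ltW.
Qed.

Let f_le x t : K (x - t *: e) -> f x <= t.
Proof. by apply: ge_inf; have [] := has_inf_f x. Qed.

Let f_lt x t : f x < t -> K (x - t *: e).
Proof.
move=> /inf_lt[|r /= Kr rt]; first by have [] := has_inf_f x.
have -> : x - t *: e = (x - r *: e) + (t - r) *: - e.
  by rewrite scalerN scalerBl opprB addrA subrK.
by apply: KD => //; apply: KZ => //; rewrite subr_ge0 ltW.
Qed.

Let f_subadd x y : f (x + y) <= f x + f y.
Proof.
apply/ler_addgt0Pr => d d0; apply: f_le.
have -> : x + y - (f x + f y + d) *: e =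
    (x - (f x + d / 2) *: e) + (y - (f y + d / 2) *: e).
  by rewrite [RHS]addrACA -[in RHS]opprD -[in RHS]scalerDl addrACA -splitr.
by apply: KD; apply: f_lt; rewrite ltrDl divr_gt0.
Qed.

(** Totality enters here: [x - (f x - d) e] lies below the infimum, hence outside [K], so its
    opposite is in [K]. *)
Let f_opp x : f (- x) <= - f x.
Proof.
apply/ler_addgt0Pr => d d0; apply: f_le.
have [Kx|] := Ktotal (x - (f x - d) *: e).
  by have := f_le Kx; rewrite leNgt ltrBlDr ltrDl d0.
by congr K; rewrite opprB addrC -[in RHS]scaleNr opprD opprK.
Qed.

Let f_add x y : f (x + y) = f x + f y.
Proof.
apply/le_anti; rewrite f_subadd/=.
(* Superadditivity: [f x = f ((x + y) - y) <= f (x + y) - f y]. *)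
rewrite -lerBrDr (le_trans _ (lerD (lexx _) (f_opp y)))//.
by rewrite -{1}[x](addrK y) f_subadd.
Qed.

Let f_oppE x : f (- x) = - f x.
Proof.
have f0 : f 0 = 0 by apply: (addrI (f 0)); rewrite -f_add !addr0.
by apply/eqP; rewrite -addr_eq0 -f_add addNr f0.
Qed.

Let f_scale_le (a : R) x : 0 < a -> f (a *: x) <= a * f x.
Proof.
move=> a0; apply/ler_addgt0Pr => d d0; apply: f_le.
have -> : a *: x - (a * f x + d) *: e = a *: (x - (f x + d / a) *: e).
  by rewrite scalerBr scalerA mulrDr mulrCA divff ?gt_eqF// mulr1.
by apply: KZ; [exact: ltW|apply: f_lt; rewrite ltrDl divr_gt0].
Qed.

Let f_scale_gt0 (a : R) x : 0 < a -> f (a *: x) = a * f x.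
Proof.
move=> a0; apply/le_anti; rewrite f_scale_le//=.
rewrite -ler_pdivlMl// -{1}[x]scale1r -(@mulVf _ a) ?gt_eqF// -scalerA.
by rewrite f_scale_le// invr_gt0.
Qed.

Let f_scale (a : R) x : f (a *: x) = a * f x.
Proof.
have [a0|a0|->] := ltgtP a 0.
- by rewrite -[a]opprK scaleNr f_oppE f_scale_gt0 ?oppr_gt0// !mulNr.
- exact: f_scale_gt0.
- by rewrite scale0r mul0r; apply: (addrI (f 0)); rewrite -f_add !addr0.
Qed.

Fact cone_functional_is_linear : linear (f : X -> R^o).
Proof. by move=> a x y; rewrite f_add f_scale. Qed.

Lemma total_cone_functional :
  exists2 g : {linear X -> R^o}, g e = 1 & forall x, K x -> g x <= 0.
Proof.
pose g : {linear X -> R^o} := HB.pack f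
  (GRing.isLinear.Build R X R^o _ f cone_functional_is_linear).
exists g => [|x Kx]; last by apply: f_le; rewrite scale0r subr0.
apply/le_anti/andP; split; first by apply: f_le; rewrite scale1r subrr.
(* If [f e < 1], the midpoint of [f e] and [1] would put a positive multiple of [e] in [K]. *)
rewrite leNgt; apply/negP => fe1.
have /f_lt : f e < (f e + 1) / 2 by move: fe1; rewrite /=; lra.
rewrite -{1}[e]scale1r -scalerBl -[_ - _]opprK scaleNr => /Ke_ge0.
by move: fe1; rewrite /=; lra.
Qed.

End TotalConeFunctional.

(** * Continuity and separation in locally convex spaces *)

Section LocallyConvex.
Context (R : realType) (X : tvsType R).
Implicit Types (A C : set X) (x y : X).

Lemma tvs_continuousD (T : topologicalType) (f g : T -> X) :
  continuous f -> continuous g -> continuous (fun t => f t + g t).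
Proof.
move=> cf cg t.
apply: (@continuous_comp T (X * X)%type X (fun t => (f t, g t))
  (fun z => z.1 + z.2)); last exact: add_continuous.
by apply: cvg_pair; [exact: cf|exact: cg].
Qed.

Lemma tvs_continuousZ (T : topologicalType) (s : T -> R^o) (f : T -> X) :
  continuous s -> continuous f -> continuous (fun t => s t *: f t).
Proof.
move=> cs cf t.
apply: (@continuous_comp T (R^o * X)%type X (fun t => (s t, f t))
  (fun z => z.1 *: z.2)); last exact: scale_continuous.
by apply: (@cvg_pair _ _ _ _ (nbhs (s t : R^o))); [exact: cs|exact: cf].
Qed.

Lemma tvs_continuous_affine (a b : X) (s : R) :
  continuous (fun x : X => a + s *: (x + b)).
Proof.
apply: tvs_continuousD; first by move=> x; exact: cvg_cst.
apply: tvs_continuousZ; first by move=> x; exact: cvg_cst.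
by apply: tvs_continuousD => x; [exact: cvg_id|exact: cvg_cst].
Qed.

(** For [y] near [x], both points [e + (y - x) / d] and [e - (y - x) / d] lie in [U]; nonnegativity
    of [f] there says [|f y - f x| <= d]. *)
Lemma linear_continuous_ge0 (f : {linear X -> R^o}) (U : set X) (e : X) :
  nbhs e U -> f e = 1 -> (forall u, U u -> 0 <= f u) -> continuous f.
Proof.
move=> Ue fe fU x; apply/cvgrPdist_le => d d0; near=> y.
have U1 : U (e + d^-1 *: (y - x)).
  near: y; apply: (@tvs_continuous_affine e (- x) d^-1 x).
  by rewrite subrr scaler0 addr0.
have U2 : U (e + (- d^-1) *: (y - x)).
  near: y; apply: (@tvs_continuous_affine e (- x) (- d^-1) x).
  by rewrite subrr scaler0 addr0.
move: (fU _ U1) (fU _ U2); rewrite !linearD !linearZ/= linearN fe.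
rewrite /GRing.scale/= !mulNr !mulrN => h1 h2.
have : `|d^-1 * (f y - f x)| <= 1 by rewrite ler_norml; apply/andP; split; lra.
rewrite normrM gtr0_norm ?invr_gt0// ler_pdivrMl// mulr1.
by rewrite distrC.
Unshelve. all: by end_near. Qed.

(* Let [U] be a convex neighbourhood of [e] missing [C].  The functional of a
   total cone containing [C] and [- U] but not [e] is nonnegative on [U], hence
   continuous. *)
Lemma cone_separation C (e : X) : convex_cone C -> ~ closure C e ->
  exists f : {linear X -> R^o},
    [/\ continuous f, forall x, C x -> f x <= 0 & 0 < f e].
Proof.
move=> cC Ce.
have [B cB [Bo Bb]] := @locally_convex _ X.
have [U [BU Ue] UC] : filter_from [set U | B U /\ U e] id (~` C).
  apply: Bb; have oC : open (~` closure C) by apply/closed_openC/closed_closure.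
  apply: filterS (open_nbhs_nbhs (conj oC Ce)) => x; apply: contra_not.
  exact: subset_closure.
have cU : convex_set U by apply: cB; exact/mem_set.
have oU : nbhs e U by apply: open_nbhs_nbhs; split=> //; exact: Bo.
have cD : convex_cone (setB C (cone U)).
  by apply: setB_convex_cone => //; apply: cone_convex_cone => //; exists e.
have DU u : U u -> setB C (cone U) (- u).
  move=> Uu; exists 0; first by case: cC.
  by exists u; rewrite ?sub0r//; exists 1; rewrite /= ?ler01//; exists u;
    rewrite ?scale1r.
have De : ~ setB C (cone U) e.
  (* If [e = c - t u], then [c = e + t u = (1 + t) v] with [v] in [U] by convexity, and [v] is also
     in the cone [C], which [U] misses. *)
  move=> [c Cc [_ [t /= t0 [u Uu <-]] eE]].
  have [v Uv vE] := convex_set_scaleD cU Ue Uu ler01 t0.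
  apply: (UC _ Uv); have -> : v = (1 + t)^-1 *: c.
    rewrite (_ : c = (1 + t) *: v) ?scalerA ?mulVf ?scale1r//.
      by rewrite gt_eqF// ltr_wpDr.
    by rewrite -vE scale1r -eE subrK.
  by have [_ _] := cC; apply=> //; rewrite invr_ge0 addr_ge0.
have [K [cK CK Ke Kt]] := total_cone_avoiding cD De.
have [//|//|//|x|f fe fK] := @total_cone_functional _ _ K e.
  (* For small positive [s], [e - s x] stays in [U], so its opposite [s x - e] is in [K]. *)
  have : nbhs (0 : R^o) [set s : R^o | U (e + s *: - x)].
    have cl : continuous (fun s : R^o => e + s *: - x).
      apply: tvs_continuousD; first by move=> s; exact: cvg_cst.
      by apply: tvs_continuousZ => s; [exact: cvg_id|exact: cvg_cst].
    by apply: (cl 0); rewrite scale0r addr0.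
  move=> /nbhs_ballP[d /= d0 dU]; exists (d / 2); first exact: divr_gt0.
  have /DU/CK : U (e + (d / 2) *: - x).
    apply: dU; rewrite /ball/= sub0r normrN gtr0_norm ?divr_gt0//.
    by rewrite ltr_pdivrMr// ltr_pMr// ltr1n.
  by rewrite scalerN opprB.
exists f; split.
- apply: (linear_continuous_ge0 oU fe) => u /DU/CK/fK.
  by rewrite linearN oppr_le0.
- move=> x Cx; apply/fK/CK; exists x => //; exists 0; rewrite ?subr0//.
  by exists 0 => //=; exists e; rewrite ?scale0r.
- by rewrite fe.
Qed.

Lemma closure_le0 (f : X -> R^o) A : continuous f ->
  (forall x, A x -> f x <= 0) -> forall x, closure A x -> f x <= 0.
Proof.
move=> cf fA x; have /closure_id clf : closed (f @^-1` [set t | t <= 0]).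
  by move/continuous_closedP: cf; apply; exact: closed_le.
by move=> /(closureS fA); rewrite -clf.
Qed.

(* By separation, the closure of [C] is the common kernel of the functionals
   [f] of the hypothesis. *)
Lemma closure_cone_subspace C : convex_cone C ->
  (forall f : {linear X -> R^o}, continuous f ->
    (forall x, C x -> f x <= 0) -> forall x, C x -> f x = 0) ->
  linear_subspace (closure C).
Proof.
move=> cC f0.
suff clE x : closure C x <-> forall f : {linear X -> R^o}, continuous f ->
    (forall x, C x -> f x <= 0) -> f x = 0.
  apply/linear_subspaceP; split; first by apply/clE => f _ _; rewrite linear0.
  move=> t x y /clE fx /clE fy; apply/clE => f cf fC.
  by rewrite linearD linearZ/= fx// fy// addr0 scaler0.
split=> [Cx f cf fC|fx].
  apply/le_anti/andP; split; first exact: closure_le0 Cx.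
  have cNf : continuous (\- f : X -> R^o) by move=> y; apply: cvgN; exact: cf.
  rewrite -oppr_le0; apply: (closure_le0 cNf _ Cx) => y Cy /=.
  by rewrite (f0 f)// oppr0.
apply: contrapT => /(cone_separation cC)[f [cf fC]].
by rewrite fx ?ltxx.
Qed.

(** * Quasi-relative interiors and proper separation *)

Lemma iri_sub_qri A : convex_set A -> iri A `<=` qri A.
Proof.
move=> cA x [Ax Lx]; split=> //.
apply: closure_cone_subspace; first exact: cone_setB1_convex.
move=> f cf fC y Cy; apply/le_anti; rewrite fC//= -oppr_le0 -linearN fC//.
exact: linear_subspaceN.
Qed.

(** By continuity [f <= 0] on the closed cone at [x]. That cone is a subspace, so it contains
    [x - y] along with [y - x], whence [f x <= f y]. *)
Lemma qri_max_const A (f : {linear X -> R^o}) x y : continuous f ->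
  qri A x -> (forall z, A z -> f z <= f x) -> A y -> f y = f x.
Proof.
move=> cf [Ax Lx] fmax Ay.
have fC z : cone (setB A [set x]) z -> f z <= 0.
  move=> [t /= t0 [_ [w Aw [_ -> <-]] <-]].
  by rewrite linearZ /= linearB mulr_ge0_le0// subr_le0 fmax.
have yx : closure (cone (setB A [set x])) (y - x).
  by apply: subset_closure; exact: cone_setB1.
have := closure_le0 cf fC (linear_subspaceN Lx yx).
rewrite opprB linearB subr_le0 => fxy.
by apply/le_anti; rewrite fmax.
Qed.

(** Without a strict pair, [f] would take one common value on both sets, and the infimum over [A]
    could not be below the supremum over [B]. *)
Lemma properly_separatedP (A B : set X) : A !=set0 -> B !=set0 ->
  properly_separated A B <-> exists f : {linear X -> R^o},
    [/\ continuous f, forall a b, A a -> B b -> f a <= f b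
      & exists a b, [/\ A a, B b & f a < f b]].
Proof.
move=> [a0 Aa0] [b0 Bb0].
split=> [[f [cf fle flt]]|[f [cf fle [a [b [Aa Bb fab]]]]]].
  have fAB a b : A a -> B b -> f a <= f b.
    move=> Aa Bb; rewrite -lee_fin.
    apply: le_trans (le_trans fle _); first by apply: ereal_sup_ubound; exists a.
    by apply: ereal_inf_lbound; exists b.
  exists f; split=> //; apply: contrapT => Nlt.
  have fE a b : A a -> B b -> f a = f b.
    move=> Aa Bb; apply/le_anti; rewrite fAB//= leNgt; apply/negP => fab.
    by apply: Nlt; exists a, b.
  move: flt; rewrite ltNge => /negP; apply.
  apply: (@le_trans _ _ (f b0)%:E).
    apply: ge_ereal_sup => _ [b Bb <-].
    by rewrite -(fE _ _ Aa0 Bb) (fE _ _ Aa0 Bb0).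
  by apply: le_ereal_inf_tmp => _ [a Aa <-]; rewrite (fE _ _ Aa Bb0).
exists f; split=> //.
  apply: ge_ereal_sup => _ [x Ax <-]; apply: le_ereal_inf_tmp => _ [y By <-].
  by rewrite lee_fin fle.
apply: (@le_lt_trans _ _ (f a)%:E); first by apply: ereal_inf_lbound; exists a.
apply: (@lt_le_trans _ _ (f b)%:E); first by rewrite lte_fin.
by apply: ereal_sup_ubound; exists b.
Qed.

End LocallyConvex.

Theorem theorem5p3 (R : realType) (X : tvsType R) (Omega1 Omega2 : set X)
    (convex1 : convex_set Omega1) (convex2 : convex_set Omega2)
    (meet12 : Omega1 `&` Omega2 !=set0)
    (iri1 : iri Omega1 !=set0) (iri2 : iri Omega2 !=set0)
    (qreg12 : quasi_regular (setB Omega1 Omega2)) :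
  properly_separated Omega1 Omega2 <-> qri Omega1 `&` qri Omega2 = set0.
Proof.
have [c [c1 c2]] := meet12.
apply: (iff_trans (properly_separatedP _ _)); [by exists c|by exists c|].
split=> [[f [cf fle [a [b [a1 b2 fab]]]]]|].
  rewrite -subset0 => x [q1 q2]; move: fab.
  (* Lying in both sets, [x] maximizes [f] over [Omega1] and minimizes it over [Omega2]. *)
  have fa : f a = f x.
    by apply: (qri_max_const cf q1) => // z z1; apply: fle => //; case: q2.
  suff -> : f b = f x by rewrite fa ltxx.
  have cNf : continuous (\- f : {linear X -> R^o}).
    by move=> y; apply: cvgN; exact: cf.
  apply: oppr_inj; apply: (qri_max_const cNf q2) => // z z2 /=.
  by rewrite lerN2; apply: fle => //; case: q1.
move=> q0; apply: contrapT => Nsep.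
have c12 := convex_setB convex1 convex2.
have B0 : setB Omega1 Omega2 0 by exists c => //; exists c; rewrite ?subrr.
have [x [x1 x2]] : iri Omega1 `&` iri Omega2 !=set0.
  (* Quasi-regularity reduces the goal to [0] being in the quasi-relative interior of the
     difference. *)
  apply: iri_setB => //; rewrite -qreg12; split=> //.
  apply: closure_cone_subspace; first exact: cone_setB1_convex.
  move=> f cf fC x Cx; apply/le_anti; rewrite fC//= leNgt; apply/negP => fx.
  (* A negative value of [f] on the cone comes from some [a - b] with [f a < f b], so [f] would
     separate properly. *)
  apply: Nsep; exists f; split=> //.
    move=> a b a1 b2; rewrite -subr_le0 -linearB; apply: fC.
    rewrite -[a - b]subr0; apply: cone_setB1.
    by exists a => //; exists b.
  move: Cx fx => [t /= t0 [_ [_ [a a1 [b b2 <-]] [_ -> <-]] <-]].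
  rewrite subr0 linearZ/= => fx; exists a, b; split=> //.
  rewrite ltNge; apply/negP => fba; move: fx; rewrite ltNge => /negP; apply.
  by rewrite mulr_ge0// linearB subr_ge0.
suff : set0 x by [].
by rewrite -q0; split; apply: iri_sub_qri.
Qed.
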